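(* Every $4$-long affine liner is Playfair and regular.
   Context: A liner is a set $X$ of points with a family of subsets called lines such that any two distinct points lie in a unique line and every line contains at least two points. For distinct $x,y$, $\overline{xy}$ is the line through them and $\overline{xx}:=\{x\}$. A set is flat if it contains $\overline{xy}$ for all its distinct points; $\overline A$ is the smallest flat containing $A$; the rank $\|A\|$ is the smallest cardinality of $B\subseteq X$ with $A\subseteq\overline B$; a plane is a flat of rank 3. For $A\subseteq X$ and $y\in X$ put $\overline{Ay}=\bigcup_{a\in A}\overline{ay}$. $X$ is $4$-long if every line has at least $4$ points. $X$ is affine if for all $o,x,y\in X$ and $p\in\overline{xy}\setminus\overline{ox}$ there exists $u\in\overline{oy}$ such that for every $v\in\overline{oy}$: $u=v$ iff $\overline{vp}\cap\overline{ox}=\varnothing$. $X$ is Playfair if for every plane $P$, line $L\subseteq P$ and point $x\in P\setminus L$ there is a unique line $\Lambda$ with $x\in\Lambda\subseteq P\setminus L$. $X$ is regular if for every flat $A\subseteq X$ and points $a\in A$, $b\in X\setminus A$, we have $\overline{A\cup\{b\}}=\bigcup_{y\in\overline{ab}}\overline{Ay}$. *)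

(* Defs.v *)
From Stdlib Require Import List.

Record Liner := {
  pt :> Type;
  is_line : (pt -> Prop) -> Prop;
  line_exists : forall x y : pt, x <> y ->
      exists L, is_line L /\ L x /\ L y;
  line_unique : forall (x y : pt) L L', x <> y ->
      is_line L -> is_line L' -> L x -> L y -> L' x -> L' y ->
      forall z, L z <-> L' z;
  line_two : forall L, is_line L -> exists x y : pt, x <> y /\ L x /\ L y
}.

Section LinerDefs.
Variable X : Liner.

Definition subset (A B : X -> Prop) : Prop := forall z, A z -> B z.
Definition set_eq (A B : X -> Prop) : Prop := forall z, A z <-> B z.

Definition lxy (x y : X) : X -> Prop :=
  fun z => (x = y /\ z = x) \/
           (x <> y /\ exists L, is_line X L /\ L x /\ L y /\ L z).

Definition flat (A : X -> Prop) : Prop :=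
  forall x y, A x -> A y -> x <> y -> subset (lxy x y) A.

Definition closure (A : X -> Prop) : X -> Prop :=
  fun z => forall F, flat F -> subset A F -> F z.

Definition rank_le (A : X -> Prop) (n : nat) : Prop :=
  exists l : list X, length l <= n /\ subset A (closure (fun x => In x l)).

Definition plane (P : X -> Prop) : Prop :=
  flat P /\ rank_le P 3 /\ ~ rank_le P 2.

Definition lAy (A : X -> Prop) (y : X) : X -> Prop :=
  fun z => exists a, A a /\ lxy a y z.

Definition four_long : Prop :=
  forall L, is_line X L -> exists a b c d : X,
    L a /\ L b /\ L c /\ L d /\
    a <> b /\ a <> c /\ a <> d /\ b <> c /\ b <> d /\ c <> d.

Definition affine : Prop :=
  forall o x y p : X, lxy x y p -> ~ lxy o x p ->
    exists u, lxy o y u /\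
      forall v, lxy o y v ->
        (u = v <-> ~ exists z, lxy v p z /\ lxy o x z).

Definition playfair : Prop :=
  forall (P L : X -> Prop) (x : X),
    plane P -> is_line X L -> subset L P -> P x -> ~ L x ->
    exists Lam, (is_line X Lam /\ Lam x /\ subset Lam (fun z => P z /\ ~ L z)) /\
      forall Lam', is_line X Lam' -> Lam' x ->
        subset Lam' (fun z => P z /\ ~ L z) -> set_eq Lam' Lam.

Definition regular : Prop :=
  forall (A : X -> Prop) (a b : X), flat A -> A a -> ~ A b ->
    set_eq (closure (fun z => A z \/ z = b))
           (fun z => exists y, lxy a b y /\ lAy A y z).

End LinerDefs.

(* Main.v *)
From Stdlib Require Import List Classical Lia.
Require Import Defs.

(** Call two points off a flat [A] linked when they are equal or their line meets [A].  By the
    affine axiom a point linked to one point of a line through [c] in [A] is linked to all its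
    points off [A] but one, so on a 4-long line two points always find a common partner: chains
    of links shorten to length 2, and [A] together with a class of linked points is flat.  This
    describes the closure of [A] and a point, and gives the exchange property.  Regularity says
    that two steps can be replaced by one step to a point of a prescribed line through [c]; it is
    proved first for lines [A], hence inside planes, and then for all flats by projecting from
    the intermediate point.  Playfair's axiom follows from exchange and regularity in planes. *)

Section AffineLiner.

(** * Collinearity and flats *)

Variable X : Liner.

(** Unlike [lxy], which shrinks to one point when its arguments coincide, the degenerate pair counts
    as collinear with everything. This makes the relation invariant under all permutations. *)
Definition Col (x y z : X) : Prop :=
  x = y \/ exists L, is_line X L /\ L x /\ L y /\ L z.

Lemma col_swap12 x y z : Col x y z -> Col y x z.
Proof.
intros [H | (L & ? & ? & ? & ?)]; [left; auto | right; exists L; auto].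
Qed.

Lemma col_swap23 x y z : Col x y z -> Col x z y.
Proof.
intros [<- | (L & ? & ? & ? & ?)]; [| right; exists L; auto].
destruct (classic (x = z)) as [<- | n]; [left; auto | right].
destruct (line_exists X x z n) as (L & ? & ? & ?); exists L; auto.
Qed.

Lemma col_aab x z : Col x x z.
Proof. left; auto. Qed.

Lemma col_aba x y : Col x y x.
Proof. apply col_swap23, col_aab. Qed.

Lemma col_abb x y : Col x y y.
Proof. apply col_swap12, col_aba. Qed.

Lemma col_line L x y z :
  is_line X L -> x <> y -> L x -> L y -> (Col x y z <-> L z).
Proof.
intros HL n Lx Ly; split; [intros [e | (L' & ? & ? & ? & ?)] | right; exists L; auto].
- contradiction.
- apply (line_unique X x y L' L n); auto.
Qed.

Lemma col3 x y a b c : x <> y -> Col x y a -> Col x y b -> Col x y c -> Col a b c.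
Proof.
intros n; destruct (line_exists X x y n) as (L & HL & Lx & Ly).
rewrite !(col_line L) by auto; right; exists L; auto.
Qed.

Lemma lxy_col x y z : x <> y -> (lxy X x y z <-> Col x y z).
Proof.
intros n; split.
- intros [[e _] | [_ H]]; [contradiction | right; auto].
- intros [e | H]; [contradiction | right; auto].
Qed.

Lemma lxy_left x y : lxy X x y x.
Proof.
destruct (classic (x = y)) as [<- | n]; [left; auto | apply lxy_col, col_aba; auto].
Qed.

Lemma lxy_right x y : lxy X x y y.
Proof.
destruct (classic (x = y)) as [<- | n]; [left; auto | apply lxy_col, col_abb; auto].
Qed.

(** Permutation symmetry, and the fact that two distinct points fix a line ([col3]), settle most
    incidence goals below. *)
Ltac colp :=
  first [ assumption | apply col_aab | apply col_aba | apply col_abb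
        | apply col_swap12; assumption | apply col_swap23; assumption
        | apply col_swap12, col_swap23; assumption
        | apply col_swap23, col_swap12; assumption
        | apply col_swap12, col_swap23, col_swap12; assumption ].
Ltac col :=
  first [ colp
        | match goal with
          | n : ?x <> ?y |- Col ?a ?b ?c => apply (col3 x y a b c n); colp
          end ].
Ltac neq :=
  let E := fresh in intro E; subst;
  first [ contradiction | congruence
        | match goal with H : ~ Col _ _ _ |- _ => apply H; col end ].

Lemma flat_col A x y z : flat X A -> A x -> A y -> x <> y -> Col x y z -> A z.
Proof.
intros F Ax Ay n C; apply (F x y Ax Ay n); apply lxy_col; auto.
Qed.

Lemma flat_of_col A :
  (forall x y z, A x -> A y -> x <> y -> Col x y z -> A z) -> flat X A.
Proof.
intros H x y Ax Ay n z Hz; apply lxy_col in Hz; eauto.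
Qed.

Lemma flat_line x y : x <> y -> flat X (Col x y).
Proof.
intros n; apply flat_of_col; intros a b c Ha Hb nab Hc.
assert (Col a b x) by col; assert (Col a b y) by col; col.
Qed.

Lemma closure_flat A : flat X (closure X A).
Proof.
intros x y Hx Hy n z Hz F FF AF.
apply (FF x y); [apply Hx | apply Hy | | ]; auto.
Qed.

Lemma closure_incl A a : A a -> closure X A a.
Proof. intros Aa F _ AF; apply AF, Aa. Qed.

(** * Long lines and the affine axiom *)

Hypothesis X4 : four_long X.

(** The only use of 4-longness. The excluded points may coincide or lie off the line. *)
Lemma fourth_point x y p q r :
  x <> y -> exists z, Col x y z /\ z <> p /\ z <> q /\ z <> r.
Proof.
intros n; destruct (line_exists X x y n) as (L & HL & Lx & Ly).
destruct (X4 L HL) as (a & b & c & d & La & Lb & Lc & Ld & ? & ? & ? & ? & ? & ?).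
assert (E : forall z, L z -> Col x y z) by (intro; apply col_line; auto).
apply NNPP; intro Q.
assert (K : forall z, L z -> z = p \/ z = q \/ z = r).
{ intros z Lz; apply NNPP; intro K; apply Q; exists z; split; [auto | tauto]. }
clear Q E.
destruct (K a La) as [? | [? | ?]], (K b Lb) as [? | [? | ?]],
  (K c Lc) as [? | [? | ?]], (K d Ld) as [? | [? | ?]]; congruence.
Qed.

Hypothesis Xaff : affine X.

(** The only use of the affine axiom. The hypotheses put [p] off both [o x] and [o y], so no line
    degenerates and [lxy] becomes [Col]. The exception [u] is where the parallel to [o x] through
    [p] cuts [o y]. *)
Lemma affine_col o x y p :
  ~ Col o x y -> Col x y p -> p <> x -> p <> y ->
  exists u, Col o y u /\ (forall z, Col u p z -> Col o x z -> False) /\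
    forall v, Col o y v -> v <> u -> exists z, Col v p z /\ Col o x z.
Proof.
intros N C px py.
assert (o <> x) by neq. assert (o <> y) by neq. assert (x <> y) by neq.
assert (np : ~ Col o y p).
{ intro. apply N. assert (p <> y) by auto. col. }
destruct (Xaff o x y p) as (u & Hu & U).
- apply lxy_col; auto.
- rewrite lxy_col by auto. intro. apply N. col.
- assert (E : forall v, Col o y v -> v <> p) by (intros v ? ->; auto).
  apply lxy_col in Hu; auto. exists u; split; [auto | split].
  + intros z Hz1 Hz2.
    apply (proj1 (U u (proj2 (lxy_col o y u H0) Hu)) eq_refl).
    exists z; rewrite !lxy_col; auto.
  + intros v Hv nv. apply NNPP; intro Q. apply nv; symmetry.
    apply U; [apply lxy_col; auto|]. intros (z & Hz1 & Hz2).
    apply Q; exists z. rewrite lxy_col in Hz1, Hz2; auto.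
Qed.

(** * Points linked over a flat *)

Definition linked (A : X -> Prop) (p q : X) : Prop :=
  ~ A p /\ ~ A q /\ (p = q \/ exists a, A a /\ Col p q a).

Definition linked2 (A : X -> Prop) (p q : X) : Prop :=
  exists t, linked A p t /\ linked A t q.

Lemma linked_sym A p q : linked A p q -> linked A q p.
Proof.
intros (? & ? & [-> | (a & Ha & ?)]); repeat split; auto.
right; exists a; split; [auto | col].
Qed.

Lemma linked_refl A p : ~ A p -> linked A p p.
Proof. repeat split; auto. Qed.

Lemma linked2_sym A p q : linked2 A p q -> linked2 A q p.
Proof. intros (t & ? & ?); exists t; split; apply linked_sym; auto. Qed.

Lemma linked_linked2 A p q : linked A p q -> linked2 A p q.
Proof. intros H; exists q; split; auto; apply linked_refl, H. Qed.

Lemma linked_flat A B p q :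
  flat X A -> subset X B A -> A q -> linked B p q -> A p.
Proof.
intros F S Aq (np & nq & [-> | (a & Ba & C)]); auto.
apply (flat_col A q a p F Aq (S _ Ba)); [intros <-; auto | col].
Qed.

Lemma linked2_flat A B p q :
  flat X A -> subset X B A -> A q -> linked2 B p q -> A p.
Proof.
intros F S Aq (t & H1 & H2).
apply (linked_flat A B p t F S); auto. apply (linked_flat A B t q F S); auto.
Qed.

Lemma not_on_flat A c v y :
  flat X A -> A c -> ~ A v -> Col c v y -> y <> c -> ~ A y.
Proof.
intros F Ac nv C n Ay; apply nv, (flat_col A c y v F); auto; col.
Qed.

(** If the link from [z] to [v] meets [A] in [e], the affine axiom in the triangle [c e v], with [z]
    on [e v], makes the lines from [z] to the points of [c v] meet [c e] with one exception. *)
Lemma linked_line A c v z :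
  flat X A -> A c -> linked A z v ->
  exists u, forall y, Col c v y -> y <> c -> y <> u -> linked A z y.
Proof.
intros F Ac (nz & nv & H).
assert (cv : c <> v) by (intros <-; auto).
destruct (classic (Col c v z)) as [Cz | Cz].
(* Here all links pass through [c], so there is no exception and [c] is a dummy value. *)
{ exists c; intros y Hy ny _; repeat split; auto.
  - apply (not_on_flat A c v y); auto.
  - right; exists c; split; auto; col. }
destruct H as [-> | (e & Ae & Ce)]; [destruct Cz; col|].
assert (c <> e) by (intros <-; apply Cz; col).
assert (N : ~ Col c e v).
{ intro Q; apply nv, (flat_col A c e v F); auto. }
destruct (affine_col c e v z N) as (u & Hu & _ & U);
  [col | intros <-; auto | intros ->; apply Cz; col |].
exists u; intros y Hy ny nu; repeat split; auto.
- apply (not_on_flat A c v y); auto.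
- right; destruct (U y Hy nu) as (a & ? & ?); exists a; split; [|col].
  apply (flat_col A c e a F); auto.
Qed.

(** Used contrapositively: once one point of [c v] other than [c] is known not to be linked to [z],
    all the others are. *)
Lemma linked_exception_unique A c v z y1 y2 :
  flat X A -> A c -> linked A z v ->
  Col c v y1 -> Col c v y2 -> y1 <> c -> y2 <> c ->
  ~ linked A z y1 -> ~ linked A z y2 -> y1 = y2.
Proof.
intros F Ac H C1 C2 n1 n2 N1 N2.
destruct (linked_line A c v z F Ac H) as (u & U).
transitivity u.
- apply NNPP; intro; apply N1, U; auto.
- apply NNPP; intro; apply N2, U; auto.
Qed.

(* Two points linked to a line through [c] each miss at most one of its points other than [c];
   a fourth point serves both. *)
Lemma linked_linked2_trans A p s q :
  flat X A -> linked A p s -> linked2 A s q -> linked2 A p q.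
Proof.
intros F H (t & Hst & Htq).
destruct (Hst) as (ns & nt & [<- | (c & Ac & Cc)]); [exists s; auto|].
assert (c <> s) by (intros <-; auto). assert (c <> t) by (intros <-; auto).
destruct (classic (s = t)) as [<- | st]; [exists s; auto|].
destruct (linked_line A c s p F Ac H) as (u & U).
destruct (linked_line A c t q F Ac (linked_sym _ _ _ Htq)) as (u' & U').
destruct (fourth_point c s c u u') as (y & Hy & ? & ? & ?); auto.
exists y; split; [apply U; auto | apply linked_sym, U'; auto; col].
Qed.

Lemma linked2_trans A p q r :
  flat X A -> linked2 A p q -> linked2 A q r -> linked2 A p r.
Proof.
intros F (t & H1 & H2) H3.
apply (linked_linked2_trans A p t r F H1).
apply (linked_linked2_trans A t q r F H2 H3).
Qed.

Lemma linked2_line_meeting A b v z p a :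
  flat X A -> linked2 A v b -> ~ A v -> z <> v -> Col z v p -> ~ A p ->
  A a -> Col z v a -> linked2 A p b.
Proof.
intros F D nv nzv Hp np Aa Ha.
apply (linked_linked2_trans A p v b F); auto.
repeat split; auto. right; exists a; split; auto. col.
Qed.

(** The line [z v] misses [A]. Let [d] in [A] lie on the link [z t]. For a point [s] of [d z] linked
    to [v], the line [s v] meets [d p] in some [r] unless [s] is exceptional; then [r] is linked to
    [p] through [d], and to [s] through the point of [s v] in [A], so the chain [p], [r], [s], [v]
    can be shortened. *)
Lemma linked2_line_parallel A z v p :
  flat X A -> linked2 A z v -> ~ linked A z v -> Col z v p ->
  linked2 A p v.
Proof.
intros F (t & Hzt & Htv) N Hp.
assert (nz : ~ A z) by apply Hzt. assert (nv : ~ A v) by apply Htv.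
assert (nt : ~ A t) by apply Hzt.
assert (zv : z <> v) by (intros <-; apply N, linked_refl; auto).
assert (disj : forall a, A a -> Col z v a -> False).
{ intros a Aa Ca; apply N; repeat split; auto. right; exists a; auto. }
destruct (classic (p = z)) as [-> | pz]; [exists t; auto|].
destruct (classic (p = v)) as [-> | pv].
{ exists v; split; apply linked_refl; auto. }
assert (np : ~ A p) by (intro; eauto).
destruct (Hzt) as (_ & _ & [<- | (d & Ad & Cd)]); [contradiction|].
assert (zt : z <> t) by (intros <-; auto).
assert (dz : d <> z) by (intros <-; auto).
assert (dt : d <> t) by (intros <-; auto).
assert (Cdv : ~ Col z v d) by (intro; eauto).
destruct (affine_col d p z v) as (u & Hu & _ & U); auto.
{ intro. apply Cdv. col. }
{ col. }
assert (K : forall s, Col d z s -> s <> u -> s <> d -> linked A s v -> linked2 A p v).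
{ intros s Hs su sd Hsv.
  destruct (U s Hs su) as (r & Hr1 & Hr2).
  assert (sv : s <> v).
  { intros ->. apply Cdv; col. }
  assert (ns : ~ A s) by apply Hsv.
  assert (nr : ~ A r).
  { intro Ar. destruct (classic (r = d)) as [-> | rd].
    - apply Cdv. assert (Col d s v) by col. assert (d <> s) by auto. col.
    - apply np, (flat_col A d r p F); auto. col. }
  apply (linked_linked2_trans A p r v F).
  - repeat split; auto. right; exists d; split; auto. col.
  - exists s; split; auto.
    destruct Hsv as (_ & _ & [-> | (e & Ae & Ce)]); [contradiction|].
    repeat split; auto. right; exists e; split; auto. col. }
(* A substitute for [t] in case [t] is the exception [u]. It is linked to [v] because [z] is already
   the one point of [d z] that is not. *)
destruct (fourth_point d z d z t) as (t' & Ht' & ? & ? & ?); auto.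
assert (Hvt' : linked A v t').
{ apply NNPP; intro Q. apply H0. symmetry.
  apply (linked_exception_unique A d t v z t' F Ad); auto using linked_sym; try col. }
destruct (classic (t = u)) as [<- | tu].
- apply (K t'); auto using linked_sym.
- apply (K t); auto. col.
Qed.

Lemma flat_linked2 A b : flat X A -> flat X (fun z => A z \/ linked2 A z b).
Proof.
intros F; apply flat_of_col; intros x y z Hx Hy n C.
destruct (classic (A z)) as [Az | nz]; [auto | right].
assert (nA : forall w, linked2 A w b -> ~ A w) by (intros w (t & H & _); apply H).
destruct Hx as [Hx | Hx], Hy as [Hy | Hy].
- destruct nz; apply (flat_col A x y z F); auto.
- apply (linked2_line_meeting A b y x z x); auto; col.
- apply (linked2_line_meeting A b x y z y); auto; col.
- destruct (classic (linked A x y)) as [(_ & _ & [e | (a & Aa & Ca)]) | N].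
  + contradiction.
  + apply (linked2_line_meeting A b y x z a); auto.
  + apply (linked2_trans A z y b F); auto.
    apply (linked2_line_parallel A x y z F); auto.
    apply (linked2_trans A x b y F); auto using linked2_sym.
Qed.

(** The right-hand side is flat by [flat_linked2], and it is the smallest candidate because a flat
    containing [A] and [b] absorbs chains of links ending at [b]. *)
Lemma closure_add A b z :
  flat X A -> ~ A b ->
  (closure X (fun x => A x \/ x = b) z <-> A z \/ linked2 A z b).
Proof.
intros F nb; split.
- intros H; apply H; [apply flat_linked2; auto|].
  intros x [Ax | ->]; auto. right; exists b; split; apply linked_refl; auto.
- intros H G FG SG. assert (subset X A G) by (intros ? ?; apply SG; auto).
  destruct H as [Az | D]; [auto|]. apply (linked2_flat G A z b); auto.
Qed.

(** * Regularity over lines *)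

Lemma linked_pencil A c b t z :
  flat X A -> A c -> linked A t b -> Col c t z -> z <> c ->
  exists y, Col c b y /\ y <> c /\ linked A z y.
Proof.
intros F Ac Htb Cz zc.
assert (nt : ~ A t) by apply Htb. assert (nb : ~ A b) by apply Htb.
assert (nz : ~ A z) by (apply (not_on_flat A c t z); auto).
assert (ct : c <> t) by (intros <-; auto). assert (cb : c <> b) by (intros <-; auto).
destruct (classic (linked A z b)) as [Hzb | Nzb]; [exists b; split; [col | auto]|].
destruct (classic (z = t)) as [-> | zt]; [contradiction|].
destruct (classic (Col c b t)) as [Cbt | Nbt].
{ destruct Nzb; repeat split; auto. right; exists c; split; auto; col. }
assert (tb : t <> b) by neq.
destruct (Htb) as (_ & _ & [e | (e & Ae & Ce)]); [contradiction|].
assert (et : e <> t) by (intros <-; auto). assert (eb : e <> b) by (intros <-; auto).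
assert (ce : c <> e) by (intros <-; apply Nbt; col).
assert (Ncet : ~ Col c e t).
{ intro; apply nt, (flat_col A c e t F); auto. }
assert (onA : forall a, Col e c a -> A a).
{ intros a ?; apply (flat_col A e c a F); auto. }
destruct (classic (exists y, Col e z y /\ Col b c y)) as [(y & Hy1 & Hy2) | Ne].
{ assert (ez : e <> z) by (intros <-; auto).
  assert (yc : y <> c).
  { intros ->. apply Ncet. assert (Col c t e) by col. col. }
  exists y; split; [col | split; auto]. repeat split; auto.
  - apply (not_on_flat A c b y); auto; col.
  - right; exists e; split; auto; col. }
(* What remains is that [e z] misses [b c] and [b z] misses [A]. Then [b] and [e] are the two
   exceptions on [t b] for lines through [z], with respect to [c e] and [b c]. Any further point [p]
   yields a line [p z] crossing both; [t] is avoided since [t z] crosses them at [c]. *)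
destruct (affine_col e c t z) as (u & Hu & _ & U); auto.
destruct (affine_col b c t z) as (u' & Hu' & _ & U'); auto.
{ intro; apply Nbt; col. }
assert (bu : b = u).
{ apply NNPP; intro bu. destruct (U b) as (a & ? & ?); auto; [col|].
  apply Nzb; repeat split; auto. right; exists a; split; auto; col. }
assert (eu' : e = u').
{ apply NNPP; intro eu. destruct (U' e) as (a & ? & ?); auto; [col|].
  apply Ne; exists a; auto. }
subst u u'.
destruct (fourth_point t b t b e) as (p & Hp & pt & pb & pe); auto.
destruct (U p) as (f & Hf1 & Hf2); auto; [col|].
destruct (U' p) as (y & Hy1 & Hy2); auto; [col|].
assert (pz : p <> z).
{ intros ->. apply Nbt. assert (t <> z) by auto. assert (Col t z c) by col. col. }
assert (yc : y <> c).
{ intros ->. apply Nbt. assert (Col c t p) by col. col. }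
exists y; split; [col | split; auto]. repeat split; auto.
- apply (not_on_flat A c b y); auto; col.
- right; exists f; split; auto; col.
Qed.

(** Both links at [t] meet the same line [c e], so one line through [t] can cross [c b] and [c z] at
    once. Its crossings [b'] and [z'] are directly linked, and [linked_pencil] moves [z'] to [z]. *)
Lemma linked2_line_regular c e b z :
  c <> e -> linked2 (Col c e) z b ->
  exists y, Col c b y /\ y <> c /\ linked (Col c e) z y.
Proof.
intros ce (t & Hzt & Htb). pose proof (flat_line c e ce) as F.
assert (nt : ~ Col c e t) by apply Hzt.
assert (nz : ~ Col c e z) by apply Hzt.
assert (nb : ~ Col c e b) by apply Htb.
assert (ct : c <> t) by neq. assert (cb : c <> b) by neq. assert (cz : c <> z) by neq.
assert (Ac : Col c e c) by col.
destruct (classic (Col c b t)) as [Cbt | Nbt]; [exists t; auto|].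
destruct (classic (Col c t z)) as [Ctz | Ntz].
{ apply (linked_pencil _ c b t z F); auto. }
assert (bt : b <> t) by neq. assert (zt : z <> t) by neq.
destruct Htb as (_ & _ & [E | (e0 & Ae & Ce)]); [destruct bt; auto|].
destruct Hzt as (_ & _ & [E | (d & Ad & Cd)]); [contradiction|].
assert (c <> e0) by (intros <-; apply Nbt; col).
assert (c <> d) by (intros <-; apply Ntz; col).
destruct (affine_col c b e0 t) as (u & Hu & _ & U); auto.
{ intro. apply nb. col. }
{ col. }
{ intros <-; auto. }
destruct (affine_col c z d t) as (u' & Hu' & _ & U'); auto.
{ intro. apply nz. col. }
{ col. }
{ intros <-; auto. }
(* A line through [t] crossing [c z], [c b] and the base. *)
destruct (fourth_point c e c u u') as (a & Ha & ac & au & au'); auto.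
destruct (U a) as (b' & Hb1 & Hb2); auto; [col|].
destruct (U' a) as (z' & Hz1 & Hz2); auto; [col|].
assert (at_ : a <> t) by (intros <-; auto).
assert (bc : b' <> c).
{ intros ->. apply nt. assert (c <> a) by auto. assert (Col c a t) by col. col. }
assert (zc : z' <> c).
{ intros ->. apply nt. assert (c <> a) by auto. assert (Col c a t) by col. col. }
destruct (linked_pencil (Col c e) c b' z' z F Ac) as (y & Hy & yc & Hzy); auto.
- repeat split.
  + apply (not_on_flat _ c z z'); auto.
  + apply (not_on_flat _ c b b'); auto.
  + right; exists a; split; auto; col.
- col.
- exists y; split; auto. col.
Qed.

(** Over the line [d e], the point [f] is linked to some point of [d t] by [linked2_line_regular].
    Since [z] is not linked to [f], it is the only exception on [d t], so [t] is linked to [f]. *)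
Lemma parallel_projection t d e z v f :
  ~ Col d e t -> Col t d z -> Col t e v -> z <> t -> v <> t -> z <> d -> v <> e ->
  (forall a, Col z v a -> Col d e a -> False) -> Col z v f ->
  exists a, Col t f a /\ Col d e a.
Proof.
intros nt Cz Cv zt vt zd ve disj Cf.
assert (de : d <> e) by neq. assert (td : t <> d) by neq. assert (te : t <> e) by neq.
destruct (classic (f = z)) as [-> | fz]; [exists d; split; col|].
pose proof (flat_line d e de) as F.
assert (nz : ~ Col d e z) by (apply (not_on_flat _ d t z); auto; col).
assert (nv : ~ Col d e v) by (apply (not_on_flat _ e t v); auto; col).
assert (nf : ~ Col d e f) by (intro; eauto).
assert (zv : z <> v).
{ intros ->. apply nt. assert (Col t v d) by col. assert (Col t v e) by col.
  assert (t <> v) by auto. col. }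
assert (Hzt : linked (Col d e) z t).
{ repeat split; auto. right; exists d; split; col. }
assert (Hvt : linked (Col d e) v t).
{ repeat split; auto. right; exists e; split; col. }
assert (Hft : linked2 (Col d e) f t).
{ destruct (flat_col _ z v f (flat_linked2 (Col d e) t F)) as [|D]; auto;
    [right | right | contradiction]; apply linked_linked2; auto. }
destruct (linked2_line_regular d e t f de Hft) as (y & Hy & yd & Hfy).
assert (Hf : linked (Col d e) f t).
{ apply NNPP; intro Q. apply zt.
  apply (linked_exception_unique (Col d e) d y f z t F); auto; try col.
  intros (_ & _ & [E | (a & ? & ?)]); [contradiction|].
  apply (disj a); auto. col. }
destruct Hf as (_ & _ & [-> | (a & ? & ?)]); [exists d|exists a]; split; col.
Qed.

(** * Regularity *)

(* If [z] were linked to no point of [c b], the plane of [z] and [c b] would meet [A] in [c]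
   only, and its lines avoiding [c] would project from [t] into [A] as soon as two of their
   points do; but some [z0] on [c z] has no projection. *)
Lemma linked2_regular A c b z :
  flat X A -> A c -> linked2 A z b ->
  exists y, Col c b y /\ y <> c /\ linked A z y.
Proof.
intros F Ac (t & Hzt & Htb).
assert (nt : ~ A t) by apply Hzt. assert (nz : ~ A z) by apply Hzt.
assert (nb : ~ A b) by apply Htb.
assert (ct : c <> t) by (intros <-; auto). assert (cb : c <> b) by (intros <-; auto).
assert (cz : c <> z) by (intros <-; auto).
destruct (classic (Col c b t)) as [Cbt | Nbt]; [exists t; auto|].
destruct (classic (Col c t z)) as [Ctz | Ntz].
{ apply (linked_pencil A c b t z F); auto. }
apply NNPP; intro bad0.
assert (bad : forall y a, Col c b y -> y <> c -> Col z y a -> A a -> False).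
{ intros y a Hy yc Ha Aa; apply bad0; exists y; repeat split; auto.
  - apply (not_on_flat A c b y); auto.
  - right; exists a; auto. }
assert (Ncbz : ~ Col c b z).
{ intro. apply (bad b c); auto; col. }
assert (bt : b <> t) by neq. assert (zt : z <> t) by neq.
destruct (Htb) as (_ & _ & [E | (e & Ae & Ce)]); [destruct bt; auto|].
destruct (Hzt) as (_ & _ & [E | (d & Ad & Cd)]); [contradiction|].
assert (cd : c <> d) by (intros <-; apply Ntz; col).
assert (zd : z <> d) by (intros <-; auto).
assert (dt : d <> t) by (intros <-; auto).
assert (Ncdt : ~ Col c d t) by (intro; apply nt, (flat_col A c d t F); auto).
assert (Ncdz : ~ Col c d z) by (intro; apply nz, (flat_col A c d z F); auto).
(* A second point [y] of [c b] linked to [t]: the two lines [b z] and [y z] will both be projected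
   from [t]. *)
destruct (linked_line A c b t F Ac Htb) as (ub & Ub).
destruct (fourth_point c b c b ub) as (y & Hy & yc & yb & yu); auto.
assert (Hty : linked A t y) by (apply Ub; auto).
assert (ny : ~ A y) by apply Hty.
assert (yt : y <> t) by (intros ->; auto).
destruct (Hty) as (_ & _ & [E | (e' & Ae' & Ce')]); [destruct yt; auto|].
(* The point [z0] of [c z] is chosen so that [t z0] is parallel to [c d]. *)
destruct (affine_col c d z t) as (z0 & Hz0 & Z0 & _); auto; [col|].
assert (z0c : z0 <> c).
{ intros ->. apply (Z0 c); col. }
assert (z0z : z0 <> z).
{ intros ->. apply (Z0 d); col. }
assert (nz0 : ~ A z0) by (apply (not_on_flat A c z z0); auto).
assert (z0t : z0 <> t) by (intros ->; apply Ntz; col).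
(* Such an [a] lies in the plane of [c d] and [t] but off [c d], so chains of links over [c d] would
   carry [t] into [A]. *)
assert (Z0A : forall a, Col t z0 a -> A a -> False).
{ intros a Ha Aa. pose proof (flat_line c d cd) as FB.
  assert (nBa : ~ Col c d a) by (intro; apply (Z0 a); auto; col).
  assert (D : Col c d a \/ linked2 (Col c d) a t).
  { pose proof (flat_linked2 (Col c d) t FB) as FD.
    assert (Dt : Col c d t \/ linked2 (Col c d) t t).
    { right; apply linked_linked2, linked_refl; auto. }
    assert (Dz : Col c d z \/ linked2 (Col c d) z t).
    { apply (flat_col _ d t z FD); auto; [left; col | col]. }
    assert (Dz0 : Col c d z0 \/ linked2 (Col c d) z0 t).
    { apply (flat_col _ c z z0 FD); auto. left; col. }
    apply (flat_col _ t z0 a FD); auto. }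
  destruct D as [D | D]; [contradiction|].
  apply nt, (linked2_flat A (Col c d) t a F); auto using linked2_sym.
  intros x Hx; apply (flat_col A c d x F); auto. }
assert (Nz0 : ~ Col c b z0).
{ intro. apply Ncbz. assert (c <> z0) by auto. col. }
(* A line through [z0] crossing [b c] in [w], [b z] in [f] and [y z] in [g]; [w] avoids [c] and the
   two exceptions. *)
destruct (affine_col b z c z0) as (u1 & _ & _ & U1); auto; [|col|].
{ intro; apply Ncbz; col. }
destruct (affine_col y z c z0) as (u2 & _ & _ & U2); auto; [|col|].
{ intro. apply Ncbz. assert (y <> c) by auto. assert (Col y c b) by col. col. }
destruct (fourth_point c b c u1 u2) as (w & Hw & wc & wu1 & wu2); auto.
destruct (U1 w) as (f & Hf1 & Hf2); auto; [col|].
destruct (U2 w) as (g & Hg1 & Hg2); auto; [col|].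
assert (wz0 : w <> z0) by (intros ->; auto).
assert (bz : b <> z) by neq.
assert (yz : y <> z) by (intros ->; auto).
assert (nw : ~ A w) by (apply (not_on_flat A c b w); auto).
assert (fz : f <> z).
{ intros ->. apply Ncbz. assert (Col z z0 w) by col. assert (Col z z0 c) by col.
  assert (Col w c z) by col. col. }
assert (fg : f <> g).
{ intros <-. apply Ncbz. assert (Col z f y) by col. assert (Col z f b) by col.
  assert (Col b y z) by col. assert (Col b y c) by col. col. }
assert (Cfgz0 : Col f g z0) by col. assert (Cfgw : Col f g w) by col.
(* A common point [a] would put [z] into the plane of [c], [a] and [b], where regularity over the
   line [c a] contradicts [bad]. *)
assert (fgA : forall a, A a -> Col f g a -> False).
{ intros a Aa Ha.
  assert (ac : c <> a).
  { intros <-. apply Nz0. assert (Col w c z0) by col. col. }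
  pose proof (flat_line c a ac) as FB.
  assert (BA : subset X (Col c a) A) by (intros x Hx; apply (flat_col A c a x F); auto).
  assert (nBb : ~ Col c a b) by (intro; apply nb, BA; auto).
  pose proof (flat_linked2 (Col c a) b FB) as FD.
  set (D := fun x => Col c a x \/ linked2 (Col c a) x b) in FD.
  assert (Db : D b) by (right; apply linked_linked2, linked_refl; auto).
  assert (Dc : D c) by (left; col). assert (Da : D a) by (left; col).
  assert (Dw : D w) by (apply (flat_col D c b w); auto).
  assert (Dy : D y) by (apply (flat_col D c b y); auto).
  assert (aw : a <> w) by (intros <-; auto).
  assert (Df : D f) by (apply (flat_col D a w f); auto; col).
  assert (Dg : D g) by (apply (flat_col D a w g); auto; col).
  (* [z] is on [f b], or on [g y] if [f = b]; if also [g = y], then [z0] would lie on [c b]. *)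
  assert (Dz : D z).
  { destruct (classic (f = b)) as [-> | fb].
    - destruct (classic (g = y)) as [-> | gy].
      + destruct Nz0. col.
      + apply (flat_col D g y z); auto; col.
    - apply (flat_col D f b z); auto; col. }
  destruct Dz as [Dz | Dz]; [apply nz, BA; auto|].
  destruct (linked2_line_regular c a b z ac Dz) as (y' & Hy' & ny' & (_ & _ & H)).
  destruct H as [<- | (a' & Ha' & Ca')]; [auto|].
  apply (bad y' a'); auto. }
(* By [bad] the line [v z] misses [A], while [v] and [z] project from [t] to [e1] and [d]; hence all
   its points project into [A]. *)
assert (proj : forall e1 v h, A e1 -> Col t v e1 -> Col c b v -> v <> c -> v <> t ->
  Col v z h -> exists a, A a /\ Col t h a).
{ intros e1 v h Ae1 Ce1 Hv vc vt Hh.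
  assert (nv : ~ A v) by (apply (not_on_flat A c b v); auto).
  assert (te1 : t <> e1) by (intros <-; auto).
  assert (de1 : d <> e1).
  { intros <-. apply (bad v d); auto; col. }
  destruct (parallel_projection t d e1 z v h) as (a & ? & ?); auto; try col.
  - intro; apply nt, (flat_col A d e1 t F); auto.
  - intros <-; auto.
  - intros a Ha1 Ha2; apply (bad v a); auto. apply (flat_col A d e1 a F); auto.
  - exists a; split; auto. apply (flat_col A d e1 a F); auto. }
destruct (proj e b f) as (f' & Af' & Cf'); auto; [col|].
destruct (proj e' y g) as (g' & Ag' & Cg'); auto.
assert (ft : f <> t).
{ intros ->. apply (bad b d); auto; [col|]. assert (t <> z) by auto. col. }
assert (gt : g <> t).
{ intros ->. apply (bad y d); auto. assert (t <> z) by auto. col. }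
assert (f't : f' <> t) by (intros ->; auto).
assert (g't : g' <> t) by (intros ->; auto).
assert (fg' : f' <> g').
{ intros <-. apply (fgA f'); auto. assert (t <> f') by auto. col. }
(* Now [f g] misses [A] and two of its points project into [A], so [z0] does too, against [Z0A]. *)
destruct (parallel_projection t f' g' f g z0) as (a & Ha1 & Ha2); auto; try col.
- intro; apply nt, (flat_col A f' g' t F); auto.
- intros ->. apply (fgA f'); auto; col.
- intros ->. apply (fgA g'); auto; col.
- intros a Ha1 Ha2. apply (fgA a); auto. apply (flat_col A f' g' a F); auto.
- apply (Z0A a); auto. apply (flat_col A f' g' a F); auto.
Qed.

Lemma affine_regular : regular X.
Proof.
intros A a b F Aa nb z; split.
- intros H; apply closure_add in H; auto. destruct H as [Az | D].
  + exists a; split; [apply lxy_left|]. exists z; split; [auto | apply lxy_left].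
  + assert (ab : a <> b) by (intros <-; auto).
    destruct (linked2_regular A a b z F Aa D) as (y & Hy & ya & (nz & ny & H)).
    exists y; split; [apply lxy_col; auto|].
    destruct H as [-> | (c & Ac & Cc)].
    * exists a; split; [auto | apply lxy_right].
    * exists c; split; auto. assert (c <> y) by (intros <-; auto).
      destruct (classic (z = y)) as [-> | zy]; [apply lxy_right|].
      apply lxy_col; auto; col.
- intros (y & Hy & c & Ac & Hz).
  set (S := fun x : X => A x \/ x = b).
  assert (G : flat X (closure X S)) by apply closure_flat.
  assert (SA : forall x, A x -> closure X S x) by (intros; apply closure_incl; left; auto).
  assert (ab : a <> b) by (intros <-; auto).
  assert (Sy : closure X S y).
  { apply (G a b); auto. apply closure_incl; right; auto. }
  destruct Hz as [[_ ->] | [n H]]; [auto|].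
  apply (flat_col _ c y z G); auto. right; auto.
Qed.

(** * Exchange in planes *)

Lemma closure_mono A B : subset X A B -> subset X (closure X A) (closure X B).
Proof. intros S z H F FF SF; apply H; auto. intros x Hx; apply SF, S, Hx. Qed.

(** By [closure_add] over the closure of [S], membership of [a] is [linked2] to [b], a symmetric
    relation. *)
Lemma closure_exchange (S : X -> Prop) a b :
  closure X (fun x => S x \/ x = b) a -> ~ closure X S a ->
  closure X (fun x => S x \/ x = a) b.
Proof.
intros H na. pose proof (closure_flat S) as F.
assert (G : closure X (fun x => closure X S x \/ x = b) a).
{ revert H; apply closure_mono; intros x [Sx | ->]; auto. left; apply closure_incl, Sx. }
assert (nb : ~ closure X S b).
{ intro Sb; apply na, G; auto. intros x [Sx | ->]; auto. }
apply closure_add in G; auto. destruct G as [G | G]; [contradiction|].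
apply linked2_sym in G.
apply (linked2_flat _ (closure X S) b a); auto using closure_flat.
- apply closure_mono; intros x Sx; left; auto.
- apply closure_incl; right; auto.
Qed.

Definition span3 (a b c : X) : X -> Prop := closure X (fun x => x = a \/ x = b \/ x = c).

Lemma span3_min F a b c : flat X F -> F a -> F b -> F c -> subset X (span3 a b c) F.
Proof. intros FF ? ? ? z H; apply H; auto. intros x [-> | [-> | ->]]; auto. Qed.

Lemma span3_flat a b c : flat X (span3 a b c).
Proof. apply closure_flat. Qed.

Lemma span3_mem a b c : span3 a b c a /\ span3 a b c b /\ span3 a b c c.
Proof. repeat split; apply closure_incl; auto. Qed.

Lemma span3_exchange a b c p :
  span3 a b c p -> ~ closure X (fun x => x = a \/ x = b) p ->
  subset X (span3 a b c) (span3 a b p).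
Proof.
intros H n. destruct (span3_mem a b p) as (? & ? & ?).
apply span3_min; auto using span3_flat.
cut (closure X (fun x => (x = a \/ x = b) \/ x = p) c).
{ apply closure_mono; intros x; tauto. }
apply closure_exchange; auto. revert H; apply closure_mono; intros x; tauto.
Qed.

Lemma span3_perm a b c a' b' c' :
  (forall x, x = a \/ x = b \/ x = c -> x = a' \/ x = b' \/ x = c') ->
  subset X (span3 a b c) (span3 a' b' c').
Proof. intros H; apply closure_mono; exact H. Qed.

Lemma closure_pair p q z : p <> q -> closure X (fun x => x = p \/ x = q) z -> Col p q z.
Proof.
intros n H; apply H; [apply flat_line; auto|]. intros x [-> | ->]; col.
Qed.

(** [p] replaces [c] if it is off the span of [a] and [b]; otherwise it replaces [b], or [a] when
    equal to it. *)
Lemma span3_first a b c p :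
  span3 a b c p -> exists a' b', subset X (span3 a b c) (span3 p a' b').
Proof.
intros H.
destruct (classic (closure X (fun x => x = a \/ x = b) p)) as [H1 | N].
- destruct (classic (p = a)) as [-> | pa]; [exists b, c; intros z; auto|].
  exists a, c. destruct (span3_mem p a c) as (? & ? & ?).
  apply span3_min; auto using span3_flat.
  cut (closure X (fun x => x = a \/ x = p) b).
  { apply closure_mono; intros x; tauto. }
  apply (closure_exchange (fun x => x = a)); auto.
  intro Q; apply pa; apply (Q (fun x => x = a)); [|intros x; auto].
  intros x y -> -> []; auto.
- exists a, b; intros z Hz. apply (span3_exchange a b c p H N) in Hz.
  revert Hz; apply span3_perm; tauto.
Qed.

Lemma span3_second p a b q :
  p <> q -> span3 p a b q -> exists c, subset X (span3 p a b) (span3 p q c).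
Proof.
intros pq H.
destruct (classic (closure X (fun x => x = p \/ x = a) q)) as [H1 | N].
- exists b. destruct (span3_mem p q b) as (? & ? & ?).
  apply span3_min; auto using span3_flat.
  destruct (classic (p = a)) as [<- | pa]; [auto|].
  apply closure_pair in H1; auto. apply (flat_col _ p q a (span3_flat p q b)); auto. col.
- exists a; intros z Hz. apply (span3_exchange p a b q H N) in Hz.
  revert Hz; apply span3_perm; tauto.
Qed.

(** * Parallels in planes *)

Lemma plane_linked2 P p q r z :
  plane X P -> P p -> P q -> P r -> ~ Col p q r -> P z ->
  Col p q z \/ linked2 (Col p q) z r.
Proof.
intros (FP & (l & Hl & Pl) & _) Pp Pq Pr N Pz.
assert (pq : p <> q) by neq.
assert (exists a b c, subset X P (span3 a b c)) as (a & b & c & S).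
(* Shorter lists are padded to a triple; three exchanges then turn it into [p], [q], [r]. *)
{ assert (exists a b c, forall x, In x l -> x = a \/ x = b \/ x = c) as (a & b & c & Q).
  { destruct l as [| a [| b [| c [|]]]]; simpl in *.
    - exists p, p, p; tauto.
    - exists a, a, a; intuition.
    - exists a, b, b; intuition.
    - exists a, b, c; intuition.
    - lia. }
  exists a, b, c; intros x Px. apply Pl in Px. revert Px; apply closure_mono; exact Q. }
destruct (span3_first a b c p (S _ Pp)) as (a1 & b1 & S1).
destruct (span3_second p a1 b1 q pq (S1 _ (S _ Pq))) as (c1 & S2).
assert (S3 : subset X P (span3 p q r)).
{ intros x Px. apply (span3_exchange p q c1 r); auto.
  intro Q; apply N, closure_pair; auto. }
apply (span3_min _ p q r (flat_linked2 (Col p q) r (flat_line p q pq)));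
  [left; col | left; col | right; apply linked_linked2, linked_refl; auto | auto].
Qed.

(** With [o], [o'] on [L] and a third point [y] of [o' x], the affine axiom gives [u] on [o y] such
    that [u x] misses [L]. Any other candidate is shown to pass through this same [u]. *)
Lemma affine_playfair : playfair X.
Proof.
intros P L x HP HL LP Px nx.
destruct (line_two X L HL) as (o & o' & oo' & Lo & Lo').
assert (EL : forall z, Col o o' z <-> L z) by (intro; apply col_line; auto).
assert (N : ~ Col o o' x) by (rewrite EL; auto).
assert (FP : flat X P) by apply HP.
assert (o'x : o' <> x) by neq. assert (ox : o <> x) by neq.
destruct (fourth_point o' x o' x x) as (y & Hy & yo' & yx & _); auto.
assert (Ny : ~ Col o o' y).
{ intro. apply N. assert (o' <> y) by auto. assert (Col o' y o) by col. col. }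
destruct (affine_col o o' y x) as (u & Hu & U1 & U2); auto; [col|].
assert (Noyx : ~ Col o y x).
{ intro. apply Ny. assert (x <> y) by auto. col. }
assert (ux : u <> x) by (intros ->; auto).
assert (oy : o <> y) by neq.
assert (Py : P y) by (apply (flat_col P o' x y FP); auto).
assert (Pu : P u) by (apply (flat_col P o y u FP); auto).
destruct (line_exists X u x ux) as (M & HM & Mu & Mx).
assert (EM : forall z, Col u x z <-> M z) by (intro; apply col_line; auto).
exists M; split; [split; [auto | split; [auto |]] |].
- intros z Mz; apply EM in Mz; split.
  + apply (flat_col P u x z FP); auto.
  + intro Lz; apply EL in Lz; apply (U1 z); auto.
- intros M' HM' M'x S z.
  destruct (line_two X M' HM') as (q1 & q2 & q12 & M'1 & M'2).
  assert (exists q, M' q /\ q <> x) as (q & M'q & qx).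
  { destruct (classic (q1 = x)) as [<- | ]; [exists q2 | exists q1]; auto. }
  assert (EM' : forall w, Col x q w <-> M' w) by (intro; apply col_line; auto).
  assert (disj : forall w, Col x q w -> Col o o' w -> False).
  { intros w Hw Hw'; apply EM' in Hw; apply EL in Hw'; apply (S w); auto. }
  assert (No' : ~ Col x q o') by (intro; apply (disj o'); auto; col).
  assert (No : ~ Col x q o) by (intro; apply (disj o); auto; col).
  assert (xq : x <> q) by auto.
  pose proof (flat_line x q xq) as FB.
  (* Over the line [x q], regularity links [o] to some point of [x o']. As [L] misses [x q], the
     exception is [o'], so [o] is linked to [y]. *)
  destruct (plane_linked2 P x q o' o HP) as [|D]; auto; [apply S; auto | contradiction |].
  destruct (linked2_line_regular x q o' o xq D) as (y0 & Hy0 & y0x & Hoy0).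
  assert (Hoy : linked (Col x q) o y).
  { apply NNPP; intro Q. apply yo'. symmetry.
    apply (linked_exception_unique (Col x q) x y0 o o' y FB); auto; try col.
    intros (_ & _ & [E | (a & Ha & Ca)]); [contradiction|]. apply (disj a); auto. }
  destruct Hoy as (_ & _ & [E | (u' & Hu'1 & Hu'2)]); [contradiction|].
  (* Otherwise the line [u' x], which is [x q], would meet [L]. *)
  assert (E : u' = u).
  { apply NNPP; intro u'u. destruct (U2 u' Hu'2 u'u) as (w & Hw1 & Hw2).
    apply (disj w); auto. assert (u' <> x) by (intros ->; auto). col. }
  subst u'.
  rewrite <- EM, <- EM'; split; intro; col.
Qed.

End AffineLiner.

Theorem theorem4p1p1 (X : Liner) :
  four_long X -> affine X -> playfair X /\ regular X.
Proof.
intros X4 Xaff; split; [apply affine_playfair | apply affine_regular]; auto.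
Qed.
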